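(* Let $r\ge2$ and let $\mathbf F$ be one of the classical multivariate fidelities of $r$ commuting states: the average pairwise fidelity, the Matusita fidelity, or an average $k$-wise fidelity. Its minimal extension (preparation multivariate fidelity) $\underline{\mathbf F}$ satisfies, for all quantum states $\rho_1,\ldots,\rho_r$ on a common space: (i) (Data processing) $\underline{\mathbf F}(\rho_1,\ldots,\rho_r)\le\underline{\mathbf F}(\mathcal N(\rho_1),\ldots,\mathcal N(\rho_r))$ for every quantum channel $\mathcal N$; (ii) (Symmetry) $\underline{\mathbf F}(\rho_1,\ldots,\rho_r)=\underline{\mathbf F}(\rho_{\pi(1)},\ldots,\rho_{\pi(r)})$ for every permutation $\pi$ of $\{1,\ldots,r\}$; (iii) (Faithfulness) $\underline{\mathbf F}(\rho_1,\ldots,\rho_r)=1$ if and only if $\rho_i=\rho_j$ for all $i,j$; (iv) (Direct-sum property) for every finite alphabet $\mathcal X$, probability distribution $(p(x))_{x\in\mathcal X}$ and states $(\rho_i^x)_{x\in\mathcal X}$, $i=1,\ldots,r$, $$\underline{\mathbf F}\Big(\sum_xp(x)|x\rangle\langle x|\otimes\rho_1^x,\ldots,\sum_xp(x)|x\rangle\langle x|\otimes\rho_r^x\Big)=\sum_xp(x)\underline{\mathbf F}(\rho_1^x,\ldots,\rho_r^x).$$ Furthermore, (v) (weak orthogonality) if $\rho_i\rho_j=0$ for all $i\ne j$, then $\underline{\mathbf F}(\rho_1,\ldots,\rho_r)=0$.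
   Context: All Hilbert spaces are finite-dimensional and complex. A quantum state is a positive semi-definite operator of unit trace; a quantum channel is a completely positive trace-preserving (CPTP) linear map (input and output dimensions may differ). For commuting states let $(\omega_i(x))_x$ be the eigenvalues of $\omega_i$ in a common eigenbasis. Classical multivariate fidelities: average pairwise fidelity $\frac{2}{r(r-1)}\sum_{i<j}\sum_x\sqrt{\omega_i(x)\omega_j(x)}$; Matusita fidelity $\sum_x(\omega_1(x)\cdots\omega_r(x))^{1/r}$; average $k$-wise fidelity ($2\le k\le r$) $\binom rk^{-1}\sum_{i_1<\cdots<i_k}\sum_x(\omega_{i_1}(x)\cdots\omega_{i_k}(x))^{1/k}$. Minimal extension: $$\underline{\mathbf F}(\rho_1,\ldots,\rho_r)=\sup_{\mathcal P,\ \omega_1,\ldots,\omega_r}\left\{\mathbf F(\omega_1,\ldots,\omega_r):\ \mathcal P(\omega_i)=\rho_i\ \text{for all } i\in\{1,\dots,r\}\right\},$$ where the supremum is over states $\omega_1,\ldots,\omega_r$ that are diagonal in the standard basis of some finite-dimensional space, and over classical-to-quantum (CPTP) channels $\mathcal P$ from that space. $\{|x\rangle\}_{x\in\mathcal X}$ is an orthonormal basis of $\mathbb C^{|\mathcal X|}$. *)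

(* Defs.v *)
From HB Require Import structures.
From mathcomp Require Import all_boot all_order all_algebra all_fingroup.
From mathcomp Require Import spectral sesquilinear.
From mathcomp Require Import complex mxtens.
From mathcomp Require Import all_classical all_reals all_analysis.

Set Implicit Arguments.
Unset Strict Implicit.
Unset Printing Implicit Defensive.

Import Order.TTheory GRing.Theory Num.Theory.
Local Open Scope classical_set_scope.
Local Open Scope sesquilinear_scope.
Local Open Scope ring_scope.

Section Quantum.
Variable R : realType.
Local Notation C := R[i].

(* [0 <= z] on [R[i]] means that z is real and nonnegative; over the complex
   numbers this makes a positive semi-definite matrix automatically Hermitian. *)
Definition psd n (A : 'M[C]_n) : Prop :=
  forall v : 'cV[C]_n, 0 <= (v ^t* *m A *m v) ord0 ord0.

Definition is_state n (A : 'M[C]_n) : Prop := psd A /\ \tr A = 1.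

Definition trace_preserving n m (N : 'M[C]_n -> 'M[C]_m) : Prop :=
  forall A, \tr (N A) = \tr A.

(* The block (i, j) of A, seen as an operator on C^k (x) C^n. *)
Definition tens_block k n (A : 'M[C]_(k * n)) (i j : 'I_k) : 'M[C]_n :=
  \matrix_(a, b) A (mxtens_index (i, a)) (mxtens_index (j, b)).

(* id_k (x) N, applied blockwise; see [ampliation_tens]. *)
Definition ampliation k n m (N : 'M[C]_n -> 'M[C]_m) (A : 'M[C]_(k * n)) :
    'M[C]_(k * m) :=
  \sum_(i < k) \sum_(j < k) delta_mx i j *t N (tens_block A i j).

Lemma ampliation_tens k n m (N : {linear 'M[C]_n -> 'M[C]_m})
    (A : 'M[C]_k) (B : 'M[C]_n) :
  ampliation N (A *t B) = A *t N B.
Proof.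
apply/matrixP => s t; rewrite /ampliation summxE.
case: (mxtens_indexP s) => i a; case: (mxtens_indexP t) => j b.
have blockE i' j' : tens_block (A *t B) i' j' = A i' j' *: B.
  by apply/matrixP => a' b'; rewrite !mxE !mxtens_indexK.
rewrite (bigD1 i) //= summxE (bigD1 j) //= !big1 ?addr0.
- by rewrite blockE linearZ !mxE !mxtens_indexK /= !eqxx mul1r.
- move=> i' ne; rewrite summxE big1 // => j' _.
  by rewrite !mxE !mxtens_indexK /= eq_sym (negbTE ne) mul0r.
- move=> j' ne.
  by rewrite !mxE !mxtens_indexK /= [_ == j']eq_sym (negbTE ne) andbF mul0r.
Qed.

Definition completely_positive n m (N : 'M[C]_n -> 'M[C]_m) : Prop :=
  forall k (A : 'M[C]_(k * n)), psd A -> psd (ampliation N A).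

Definition is_channel n m (N : {linear 'M[C]_n -> 'M[C]_m}) : Prop :=
  completely_positive N /\ trace_preserving N.

(* Classical-to-quantum: the channel depends on its input only through the
   diagonal in the standard basis, sending |x><x| to the state P(|x><x|). *)
Definition is_cq_channel d n (P : {linear 'M[C]_d -> 'M[C]_n}) : Prop :=
  is_channel P /\
  forall A : 'M[C]_d, P A = \sum_(x < d) A x x *: P (delta_mx x x).

(* The operator sum_x p(x) |x><x| (x) rho_x, with the alphabet X indexing the
   standard basis of C^#|X| through its enumeration. *)
Definition cq_operator (X : finType) n (p : X -> R) (rho : X -> 'M[C]_n) :
    'M[C]_(#|X| * n) :=
  \sum_(x : X) (real_complex R (p x)) *:
    (delta_mx (enum_rank x) (enum_rank x) *t rho x).

Definition is_distribution (X : finType) (p : X -> R) : Prop :=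
  (forall x, 0 <= p x) /\ \sum_(x : X) p x = 1.

Section Fidelity.
Variable r : nat.

(* A functional of r commuting states, given through their eigenvalues
   [w i x] in a common eigenbasis indexed by [x : 'I_d], for every d. *)
Definition classical_functional := forall d, ('I_r -> 'I_d -> R) -> R.

Definition avg_pairwise_fidelity : classical_functional := fun d w =>
  2%:R / (r%:R * (r%:R - 1)) *
  \sum_(i < r) \sum_(j < r | (i < j)%N) \sum_(x < d) Num.sqrt (w i x * w j x).

Definition matusita_fidelity : classical_functional := fun d w =>
  \sum_(x < d) (\prod_(i < r) w i x) `^ (r%:R^-1).

Definition avg_kwise_fidelity (k : nat) : classical_functional := fun d w =>
  ('C(r, k)%:R)^-1 *
  \sum_(S : {set 'I_r} | #|S| == k)
    \sum_(x < d) (\prod_(i in S) w i x) `^ (k%:R^-1).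

Inductive classical_fidelity : classical_functional -> Prop :=
| ClassicalAvgPairwise : classical_fidelity avg_pairwise_fidelity
| ClassicalMatusita : classical_fidelity matusita_fidelity
| ClassicalAvgKwise k of (2 <= k <= r)%N :
    classical_fidelity (avg_kwise_fidelity k).

(* The eigenvalues of a diagonal state in the standard basis are its (real)
   diagonal entries. *)
Definition diag_spectrum d (omega : 'I_r -> 'M[C]_d) (i : 'I_r) (x : 'I_d) : R :=
  complex.Re (omega i x x).

Definition preparation_values (F : classical_functional) n
    (rho : 'I_r -> 'M[C]_n) : set R :=
  [set v | exists (d : nat) (omega : 'I_r -> 'M[C]_d)
             (P : {linear 'M[C]_d -> 'M[C]_n}),
      [/\ forall i, is_state (omega i) /\ is_diag_mx (omega i),
          is_cq_channel P,
          forall i, P (omega i) = rho i &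
          v = F d (diag_spectrum omega)]].

Definition minimal_extension (F : classical_functional) n
    (rho : 'I_r -> 'M[C]_n) : R :=
  sup (preparation_values F rho).

End Fidelity.
End Quantum.

(* Main.v *)
From HB Require Import structures.
Require Import Defs.
From mathcomp Require Import all_boot all_order all_algebra all_fingroup.
From mathcomp Require Import spectral sesquilinear.
From mathcomp Require Import complex mxtens.
From mathcomp Require Import all_classical all_reals all_analysis.
From mathcomp Require Import zify ring lra.
Import Order.TTheory GRing.Theory Num.Theory.
Local Open Scope ring_scope.

Set Implicit Arguments.
Unset Strict Implicit.
Unset Printing Implicit Defensive.

(** A preparation of (rho_i) is a family of states sigma_t with distributions
    w_i such that rho_i = sum_t w_i(t) sigma_t, and its value is
    sum_t f(w_1(t), ..., w_r(t)) for a nonnegative, symmetric, homogeneous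
    function f: an average of geometric means (k = 2 gives the pairwise and
    k = r the Matusita fidelity). Applying a channel to the sigma_t gives data
    processing. Faithfulness is robust because of a quantitative AM-GM
    inequality, f(u) <= mean(u) - c (sqrt u_i - sqrt u_j)^2: a value close to 1
    makes w_i and w_j close in Hellinger, hence in l1, distance. For the
    direct-sum property, preparations of the summands are glued, and conversely
    a preparation of the sum is compressed to each block, where homogeneity of
    f absorbs the probability of that block. For orthogonal states,
    0 = tr(rho_i rho_j) dominates w_i(t) w_j(t) tr(sigma_t^2). *)

(** * Positive semi-definite matrices and Gram factorizations *)

Section PositiveSemidefinite.
Local Open Scope sesquilinear_scope.
Variable R : realType.
Local Notation C := R[i].

Lemma adjmxM m n p (A : 'M[C]_(m, n)) (B : 'M[C]_(n, p)) :
  (A *m B)^t* = B^t* *m A^t*.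
Proof. by rewrite trmx_mul map_mxM. Qed.

Lemma adjmx_tens m n p q (A : 'M[C]_(m, n)) (B : 'M[C]_(p, q)) :
  (A *t B)^t* = A^t* *t B^t*.
Proof. by rewrite trmx_tens map_mxT. Qed.

Lemma sqnormE m (v : 'cV[C]_m) : (v^t* *m v) ord0 ord0 = \sum_i `|v i 0| ^+ 2.
Proof. by rewrite mxE; apply: eq_bigr => i _; rewrite !mxE normCKC. Qed.

Lemma psd_gram m n (B : 'M[C]_(m, n)) : psd (B^t* *m B).
Proof.
move=> v; rewrite mulmxA -adjmxM -mulmxA sqnormE.
by apply: sumr_ge0 => i _; rewrite exprn_ge0.
Qed.

Lemma quad_form2 n (A : 'M[C]_n) (a b : 'I_n) (z : C) :
  let v : 'cV[C]_n := delta_mx a 0 + z *: delta_mx b 0 in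
  (v^t* *m A *m v) ord0 ord0 =
  A a a + z^* * z * A b b + z * A a b + z^* * A b a.
Proof.
move=> v.
have -> : v^t* = delta_mx 0 a + z^* *: delta_mx 0 b.
  apply/rowP => c.
  by rewrite !mxE rmorphD rmorphM !rmorph_nat /= !andbT.
rewrite /v !mulmxDl !mulmxDr -!scalemxAl -!scalemxAr.
rewrite -!rowE -!colE !mxE; ring.
Qed.

(** Polarization: the form is real at [e_b + e_a] and at [e_b + 'i e_a], so [A b a + A a b] and
    ['i * (A b a - A a b)] are both real, which forces [A a b] to be the conjugate of [A b a]. *)
Lemma psd_hermitian n (A : 'M[C]_n) : psd A -> A^t* = A.
Proof.
move=> psdA; apply/matrixP => a b; rewrite !mxE.
have diag_ge0 (c : 'I_n) : 0 <= A c c.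
  have := psdA (delta_mx c 0); rewrite trmx_delta map_delta_mx.
  by rewrite -rowE -colE !mxE.
have dreal : A b b + A a a \is Num.real by rewrite rpredD ?ger0_real.
have /CrealP H1 : A b a + A a b \is Num.real.
  have := psdA (delta_mx b 0 + 1 *: delta_mx a 0).
  rewrite quad_form2 rmorph1 !mul1r -!addrA addrA => /ger0_real.
  by rewrite (rpredDl _ dreal).
have /CrealP H2 : 'i * A b a - 'i * A a b \is Num.real.
  have := psdA (delta_mx b 0 + 'i *: delta_mx a 0).
  rewrite quad_form2 conjCi -!addrA addrA => /ger0_real.
  rewrite !mulNr -expr2 sqrCi mulN1r opprK.
  by rewrite (rpredDl _ dreal).
move: H1 H2; rewrite rmorphD rmorphB !rmorphM /= conjCi => H1 H2.
have i0 : ('i : C) != 0 by rewrite neq0Ci.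
have H2' : (A a b)^* - (A b a)^* = A b a - A a b.
  by apply: (mulfI i0); rewrite mulrBr [RHS]mulrBr -H2; ring.
have : (A b a)^* *+ 2 = A a b *+ 2.
  have -> : (A b a)^* *+ 2 =
      ((A b a)^* + (A a b)^*) - ((A a b)^* - (A b a)^*) by ring.
  by rewrite H1 H2'; ring.
by move/eqP; rewrite eqrMn2r // => /eqP.
Qed.

(** Spectral theorem: the form at the i-th eigenvector is the i-th eigenvalue, which is thus
    nonnegative, and its square root scales the i-th row of the unitary [P] to give [B]. *)
Lemma psdP n (A : 'M[C]_n) : psd A -> exists B : 'M[C]_n, A = B^t* *m B.
Proof.
move=> psdA; set P := spectralmx A; set d := spectral_diag A.
have Pu : P \is unitarymx by apply: spectral_unitarymx.
have AE : A = P^t* *m diag_mx d *m P.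
  rewrite -invmx_unitary //; apply/orthomx_spectralP/hermitian_normalmx.
  by apply/is_hermitianmxP; rewrite expr0 scale1r psd_hermitian.
have d_ge0 i : 0 <= d 0 i.
  have := psdA (P^t* *m delta_mx i 0).
  rewrite AE adjmxM trmxCK -!mulmxA.
  rewrite ![P *m (P^t* *m _)]mulmxA (unitarymxP Pu) !mul1mx.
  rewrite trmx_delta map_delta_mx.
  by rewrite mulmxA -rowE -colE !mxE eqxx mulr1n.
exists (diag_mx (map_mx sqrtC d) *m P).
rewrite adjmxM tr_diag_mx map_diag_mx {1}AE !mulmxA; congr (_ *m _).
rewrite -!mulmxA; congr (_ *m _); rewrite mulmx_diag; congr diag_mx.
apply/rowP => i; rewrite !mxE /= geC0_conj ?sqrtC_ge0 //.
by rewrite -expr2 sqrtCK.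
Qed.

Lemma psd_diag n (A : 'M[C]_n) i : psd A -> 0 <= A i i.
Proof.
move=> /psdP[B ->]; rewrite mxE; apply: sumr_ge0 => k _.
by rewrite !mxE mulrC mul_conjC_ge0.
Qed.

Lemma psd_tr n (A : 'M[C]_n) : psd A -> 0 <= \tr A.
Proof. by move=> psdA; apply: sumr_ge0 => i _; apply: psd_diag. Qed.

(** With [A] a Gram matrix, [A i j] is the inner product of two columns of [B]; AM-GM in each
    coordinate gives [2 |A i j| <= A i i + A j j]. Bounding each diagonal entry by the trace
    separately also covers [i = j]. *)
Lemma psd_entry n (A : 'M[C]_n) i j : psd A -> `|A i j| <= \tr A.
Proof.
move=> psdA; have [B AE] := psdP psdA.
have AiiE k : A k k = \sum_l `|B l k| ^+ 2.
  by rewrite AE mxE; apply: eq_bigr => l _; rewrite !mxE normCKC.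
have le_tr k : A k k <= \tr A.
  rewrite /mxtrace (bigD1 k) //= lerDl sumr_ge0 // => l _; exact: psd_diag.
have : `|A i j| *+ 2 <= A i i + A j j.
  rewrite 2!AiiE -big_split /= {1}AE mxE -mulr_natl mulrC -ler_pdivlMr //.
  apply: le_trans (ler_norm_sum _ _ _) _; rewrite ler_pdivlMr // mulr_suml.
  apply: ler_sum => l _; rewrite !mxE normrM norm_conjC.
  rewrite -subr_ge0.
  have -> : `|B l i| ^+ 2 + `|B l j| ^+ 2 - `|B l i| * `|B l j| * 2 =
            (`|B l i| - `|B l j|) ^+ 2 by ring.
  by rewrite real_exprn_even_ge0 // rpredB ?normr_real.
move=> /le_trans /(_ (lerD (le_tr i) (le_tr j))).
by rewrite -mulr2n lerMn2r.
Qed.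

Lemma psd_tens k n (A : 'M[C]_k) (B : 'M[C]_n) :
  psd A -> psd B -> psd (A *t B).
Proof.
move=> /psdP[A' ->] /psdP[B' ->].
by rewrite -tensmx_mul -adjmx_tens; apply: psd_gram.
Qed.

(** Selecting columns of a Gram factor. With [f] an embedding into tensor indices, this is
    compression to a block. *)
Lemma psd_mxsub m n (f : 'I_m -> 'I_n) (A : 'M[C]_n) :
  psd A -> psd (mxsub f f A).
Proof.
move=> /psdP[B ->].
suff -> : mxsub f f (B^t* *m B) = (colsub f B)^t* *m colsub f B.
  exact: psd_gram.
by apply/matrixP => i j; rewrite !mxE; apply: eq_bigr => k _; rewrite !mxE.
Qed.

Lemma psd0 n : psd (0 : 'M[C]_n).
Proof. by move=> v; rewrite mulmx0 mul0mx mxE. Qed.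

Lemma psdD n (A B : 'M[C]_n) : psd A -> psd B -> psd (A + B).
Proof. by move=> pA pB v; rewrite mulmxDr mulmxDl mxE addr_ge0. Qed.

Lemma psdZ n (c : C) (A : 'M[C]_n) : 0 <= c -> psd A -> psd (c *: A).
Proof.
by move=> c0 pA v; rewrite -scalemxAr -scalemxAl mxE mulr_ge0.
Qed.

Lemma psd_sum n (I : finType) (A : I -> 'M[C]_n) :
  (forall i, psd (A i)) -> psd (\sum_i A i).
Proof.
by move=> pA; elim/big_ind: _ => [|x y|i _]; [exact: psd0|exact: psdD|].
Qed.

(** By cyclicity the trace is that of the Gram matrix of [B' *m A'^t*]. *)
Lemma psd_trM n (A B : 'M[C]_n) : psd A -> psd B -> 0 <= \tr (A *m B).
Proof.
move=> /psdP[A' ->] /psdP[B' ->].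
rewrite -mulmxA mxtrace_mulC !mulmxA -[X in \tr X]mulmxA.
rewrite -[X in \tr (X *m _)]trmxCK adjmxM trmxCK.
exact/psd_tr/psd_gram.
Qed.

Lemma psd_tr0 n (A : 'M[C]_n) : psd A -> \tr A = 0 -> A = 0.
Proof.
move=> pA tA; apply/matrixP => i j; rewrite mxE; apply/eqP.
by rewrite -normr_le0 -tA psd_entry.
Qed.

Lemma psd_sqr_eq0 n (A : 'M[C]_n) : psd A -> \tr (A *m A) = 0 -> A = 0.
Proof.
move=> pA; rewrite -{1}(psd_hermitian pA) => trAA.
have /matrixP AA : A^t* *m A = 0.
  by apply: psd_tr0 trAA; apply: psd_gram.
apply/matrixP => i j; rewrite mxE; apply/eqP; rewrite -normr_eq0 -sqrf_eq0.
have := AA j j; rewrite mxE [RHS]mxE => /eqP.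
rewrite psumr_eq0 => [/allP/(_ i)|k _]; last first.
  by rewrite !mxE mulrC mul_conjC_ge0.
by rewrite mem_index_enum !mxE -normCKC => /(_ isT).
Qed.

End PositiveSemidefinite.

(** * States, channels and measure-and-prepare maps *)

Section Preparations.
Local Open Scope sesquilinear_scope.
Variable R : realType.
Local Notation C := R[i].
Local Notation toC := (real_complex R).

Lemma psd1 n : psd (1%:M : 'M[C]_n).
Proof.
have -> : 1%:M = 1%:M^t* *m 1%:M :> 'M[C]_n; last exact: psd_gram.
by rewrite mulmx1 trmx1 map_mx1.
Qed.

Lemma psd_delta n (x : 'I_n) : psd (delta_mx x x : 'M[C]_n).
Proof.
have -> : delta_mx x x = (delta_mx 0 x : 'rV[C]_n)^t* *m delta_mx 0 x.
  by rewrite trmx_delta map_delta_mx mul_delta_mx.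
exact: psd_gram.
Qed.

Lemma toC_ge0 (c : R) : (0 <= toC c) = (0 <= c).
Proof. exact: ler0c. Qed.

Lemma state_delta n (x : 'I_n) : is_state (delta_mx x x : 'M[C]_n).
Proof.
split; first exact: psd_delta.
rewrite /mxtrace (bigD1 x) //= big1 => [|y yx]; rewrite mxE ?eqxx ?addr0 //.
by rewrite (negbTE yx).
Qed.

Lemma state_mix (T : finType) n (p : T -> R) (sigma : T -> 'M[C]_n) :
  is_distribution p -> (forall t, is_state (sigma t)) ->
  is_state (\sum_t toC (p t) *: sigma t).
Proof.
move=> [p0 p1] st; split.
  by apply: psd_sum => t; apply: psdZ; [rewrite toC_ge0 | case: (st t)].
rewrite raddf_sum /= -(rmorph1 toC) -p1 rmorph_sum; apply: eq_bigr => t _.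
by rewrite mxtraceZ (st t).2 mulr1.
Qed.

Lemma state_tens k n (A : 'M[C]_k) (B : 'M[C]_n) :
  is_state A -> is_state B -> is_state (A *t B).
Proof.
move=> [pA tA] [pB tB]; split; first exact: psd_tens.
rewrite -[RHS](mulr1 1) -{1}tA -tB /mxtrace mulr_sum.
by apply: eq_bigr => i _; rewrite mxE.
Qed.

(** Positivity is complete positivity at [k = 1], read through the identification of [C^1 (x) C^n]
    with [C^n]. *)
Lemma state_channel n m (N : {linear 'M[C]_n -> 'M[C]_m}) (A : 'M[C]_n) :
  is_channel N -> is_state A -> is_state (N A).
Proof.
move=> [cpN tpN] [pA tA]; split; last by rewrite tpN.
have := cpN 1 _ (psd_tens (@psd1 1) pA); rewrite ampliation_tens.
move/(psd_mxsub (fun a => mxtens_index (ord0, a))).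
congr psd; apply/matrixP => a b; rewrite mxE tensmxE mxE eqxx.
by rewrite mul1r.
Qed.

(** Normal form of a classical-to-quantum channel: measure in the standard basis, then prepare
    [sigma x]. *)
Definition cq_map d n (sigma : 'I_d -> 'M[C]_n) (A : 'M[C]_d) : 'M[C]_n :=
  \sum_x A x x *: sigma x.

Lemma cq_map_is_linear d n (sigma : 'I_d -> 'M[C]_n) : linear (cq_map sigma).
Proof.
move=> c A B; rewrite /cq_map scaler_sumr -big_split; apply: eq_bigr => x _.
by rewrite !mxE scalerDl scalerA.
Qed.

HB.instance Definition _ d n (sigma : 'I_d -> 'M[C]_n) :=
  GRing.isLinear.Build C 'M[C]_d 'M[C]_n *:%R (cq_map sigma)
    (cq_map_is_linear sigma).

Lemma cq_map_delta d n (sigma : 'I_d -> 'M[C]_n) x :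
  cq_map sigma (delta_mx x x) = sigma x.
Proof.
rewrite /cq_map (bigD1 x) //= mxE eqxx scale1r big1 ?addr0 // => y yx.
by rewrite mxE (negbTE yx) scale0r.
Qed.

(** Each summand is a compression of [A] tensored with [sigma x], so complete positivity can be read
    off. *)
Lemma ampliation_cq_map k d n (sigma : 'I_d -> 'M[C]_n) (A : 'M[C]_(k * d)) :
  ampliation (cq_map sigma) A =
  \sum_x mxsub (fun i => mxtens_index (i, x)) (fun i => mxtens_index (i, x)) A
         *t sigma x.
Proof.
apply/matrixP => s t; rewrite /ampliation !summxE.
case: (mxtens_indexP s) => i a; case: (mxtens_indexP t) => j b.
set rhs := (X in _ = X).
rewrite (bigD1 i) //= summxE (bigD1 j) //= !big1 ?addr0.
- rewrite tensmxE mxE !eqxx mul1r /cq_map summxE; apply: eq_bigr => x _.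
  by rewrite tensmxE !mxE.
- move=> i' ne; rewrite summxE big1 // => j' _.
  by rewrite tensmxE mxE eq_sym (negbTE ne) mul0r.
- move=> j' ne.
  by rewrite tensmxE mxE [_ == j']eq_sym (negbTE ne) andbF mul0r.
Qed.

Lemma cq_map_channel d n (sigma : 'I_d -> 'M[C]_n) :
  (forall x, is_state (sigma x)) -> is_cq_channel (cq_map sigma).
Proof.
move=> st; split; [split|].
- move=> k A pA; rewrite ampliation_cq_map; apply: psd_sum => x.
  by apply: psd_tens; [exact: psd_mxsub | case: (st x)].
- move=> A; rewrite /= /cq_map raddf_sum /=; apply: eq_bigr => x _.
  by rewrite mxtraceZ (st x).2 mulr1.
- by move=> A; apply: eq_bigr => x _; rewrite /= cq_map_delta.
Qed.

(** * Preparations as weights and states *)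

Variable r : nat.

(** The alphabet is an arbitrary finite type, so that glued preparations can be indexed by dependent
    pairs. *)
Definition is_preparation (T : finType) n (w : 'I_r -> T -> R)
    (sigma : T -> 'M[C]_n) (rho : 'I_r -> 'M[C]_n) : Prop :=
  [/\ forall i, is_distribution (w i), forall t, is_state (sigma t) &
      forall i, rho i = \sum_t toC (w i t) *: sigma t].

(** A classical-to-quantum channel amounts to its outputs on the basis projectors, and a diagonal
    state to its probability vector. *)
Lemma preparation_valuesP (F : classical_functional R r) n
    (rho : 'I_r -> 'M[C]_n) (v : R) :
  preparation_values F rho v <->
  exists d (w : 'I_r -> 'I_d -> R) (sigma : 'I_d -> 'M[C]_n),
    is_preparation w sigma rho /\ v = F d w.
Proof.
split=> [[d [omega [P [om_st [P_ch P_diag] P_om ->]]]] |].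
  (* Diagonal entries of a positive semi-definite matrix are real, so taking real parts loses
     nothing. *)
  have om_toC i x : toC (diag_spectrum omega i x) = omega i x x.
    apply: RRe_real; apply: ger0_real; apply: psd_diag.
    by case: (om_st i) => [[]].
  exists d, (diag_spectrum omega), (fun x => P (delta_mx x x)).
  split=> //; split=> [i|x|i].
  - case: (om_st i) => [[om_psd om_tr] _]; split=> [x|].
      by rewrite -toC_ge0 om_toC; apply: psd_diag.
    apply: (@complexI R); rewrite rmorph_sum rmorph1 -om_tr.
    by apply: eq_bigr => x _; rewrite /= om_toC.
  - exact/(state_channel P_ch)/state_delta.
  - by rewrite -P_om P_diag; apply: eq_bigr => x _; rewrite om_toC.
move=> [d [w [sigma [[w_distr sigma_st rhoE] ->]]]].
pose omega i : 'M[C]_d := diag_mx (\row_x toC (w i x)).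
have omE i : omega i = \sum_x toC (w i x) *: delta_mx x x.
  by rewrite /omega diag_mx_sum_delta; apply: eq_bigr => x _; rewrite mxE.
exists d, omega, (cq_map sigma); split.
- move=> i; split; last exact: diag_mx_is_diag.
  by rewrite omE; apply: state_mix => // x; apply: state_delta.
- exact: cq_map_channel.
- move=> i; rewrite rhoE; apply: eq_bigr => x _.
  by rewrite !mxE eqxx mulr1n.
- congr F; apply/funext => i; apply/funext => x.
  by rewrite /diag_spectrum !mxE eqxx mulr1n.
Qed.

End Preparations.

(** * The classical fidelities as sums of homogeneous densities *)

Section FidelityDensities.
Variable R : realType.
Variable r : nat.

(** What the arguments on minimal extensions require of the contribution of one letter, so that all
    the fidelities are treated at once. In [density_stable] the mean may be any linear form with
    coefficients of sum 1, since summing it over distributions gives 1. *)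
Record fidelity_density (f : ('I_r -> R) -> R) : Prop := FidelityDensity {
  density_ge0 : forall u, 0 <= f u;
  density_scale : forall c u, 0 <= c -> (forall i, 0 <= u i) ->
    f (fun i => c * u i) = c * f u;
  density_perm : forall (s : {perm 'I_r}) u, f (fun i => u (s i)) = f u;
  density1 : f (fun=> 1) = 1;
  density_ortho : forall u, (forall i j, i != j -> u i * u j = 0) -> f u = 0;
  density_stable : exists a c, [/\ \sum_i a i = 1, 0 < c &
    forall u i j, (forall l, 0 <= u l) -> i != j ->
    f u <= \sum_l a l * u l - c * (Num.sqrt (u i) - Num.sqrt (u j)) ^+ 2] }.

Definition kwise_density (k : nat) (u : 'I_r -> R) : R :=
  ('C(r, k)%:R)^-1 *
  \sum_(S : {set 'I_r} | #|S| == k) (\prod_(i in S) u i) `^ (k%:R^-1).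

Lemma avg_kwise_densityE k d (w : 'I_r -> 'I_d -> R) :
  avg_kwise_fidelity k w = \sum_x kwise_density k (w^~ x).
Proof.
by rewrite /avg_kwise_fidelity exchange_big /= mulr_sumr.
Qed.

Lemma matusita_kwiseE d (w : 'I_r -> 'I_d -> R) :
  matusita_fidelity w = avg_kwise_fidelity r w.
Proof.
rewrite /matusita_fidelity /avg_kwise_fidelity binn invr1 mul1r.
rewrite (big_pred1 [set: 'I_r]) => [|S]; last first.
  rewrite /= eqEcard finset.subsetT cardsT card_ord /= eqn_leq.
  by rewrite -[X in (_ <= X)%N]card_ord max_card.
apply: eq_bigr => x _; congr (_ `^ _).
by apply: eq_bigl => i; rewrite inE.
Qed.

(** A two-element set of indices has exactly one increasing enumeration. *)
Lemma big_set2_ltn (G : {set 'I_r} -> R) :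
  \sum_(S : {set 'I_r} | #|S| == 2) G S =
  \sum_(i < r) \sum_(j < r | (i < j)%N) G [set i; j].
Proof.
rewrite pair_big_dep /=.
rewrite -(big_imset G (h := fun p : 'I_r * 'I_r => [set p.1; p.2])
  (A := [pred p : 'I_r * 'I_r | (p.1 < p.2)%N])) /=.
  apply: eq_bigl => S; apply/idP/imsetP => [/cards2P[i [j [ij ->]]]|];
      last first.
    move=> [[i j] /= ij ->]; rewrite cards2.
    by move: ij; rewrite inE /= ltn_neqAle => /andP[-> _].
  case: (ltngtP i j) => [lt|lt|/val_inj ijE].
  - by exists (i, j).
  - by exists (j, i) => //=; rewrite finset.setUC.
  - by rewrite ijE eqxx in ij.
move=> [i j] [i' j']; rewrite !inE /= => lt lt' /setP E.
have := E i; have := E j; have := E i'; have := E j'.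
rewrite !inE !eqxx ?orbT /=.
rewrite -!(inj_eq val_inj) /=.
move=> H1 H2 H3 H4; congr (_, _); apply: val_inj => /=; lia.
Qed.

Lemma avg_pairwise_kwiseE d (w : 'I_r -> 'I_d -> R) :
  (forall i x, 0 <= w i x) -> avg_pairwise_fidelity w = avg_kwise_fidelity 2 w.
Proof.
move=> w0; rewrite /avg_pairwise_fidelity /avg_kwise_fidelity big_set2_ltn.
congr (_ * _).
  (* For [r = 0] both prefactors are 0 because the inverse of 0 is 0. *)
  have [->|r_gt0] := posnP r; first by rewrite bin0n mul0r invr0 mulr0.
  have : ('C(r, 2) * 2 = r * r.-1)%N by rewrite (bin_ffact r 2) ffactnS ffactn1.
  move/(congr1 (fun n => n%:R : R)); rewrite !natrM -subn1 natrB // => <-.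
  by rewrite invfM mulrCA mulfV ?mulr1 // pnatr_eq0.
apply: eq_bigr => i _; apply: eq_bigr => j ij; apply: eq_bigr => x _.
rewrite big_setU1 ?big_set1; last by rewrite inE neq_ltn ij.
by rewrite powR12_sqrt ?mulr_ge0.
Qed.

Lemma kwise_card_gt0 k : (k <= r)%N -> 0 < ('C(r, k)%:R : R).
Proof. by move=> kr; rewrite ltr0n bin_gt0. Qed.

Lemma sum_card_bin (k : nat) :
  \sum_(S : {set 'I_r} | #|S| == k) (1 : R) = 'C(r, k)%:R.
Proof.
rewrite -[in RHS](card_ord r) -card_draws -sum1_card natr_sum.
by apply: eq_bigl => S; rewrite inE.
Qed.

Lemma exprn_powR_invn (k : nat) (x : R) : (0 < k)%N -> 0 <= x ->
  (x ^+ k) `^ (k%:R^-1) = x.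
Proof.
move=> k0 x0; rewrite -powR_mulrn // -powRrM mulfV ?powRr1 //.
by rewrite pnatr_eq0 -lt0n.
Qed.

Lemma geometric_mean_le (S : {set 'I_r}) (u : 'I_r -> R) :
  (forall l, 0 <= u l) -> (0 < #|S|)%N ->
  (\prod_(l in S) u l) `^ (#|S|%:R^-1) <= #|S|%:R^-1 * \sum_(l in S) u l.
Proof.
move=> u0 S0.
have mean0 : 0 <= #|S|%:R^-1 * \sum_(l in S) u l.
  by rewrite mulr_ge0 ?invr_ge0 ?sumr_ge0.
(* The mean is written as a root of its own power, so that monotonicity of the root reduces the
   claim to AM-GM in power form. *)
rewrite -[leRHS](exprn_powR_invn S0) //.
apply: ge0_ler_powR; rewrite ?invr_ge0 ?nnegrE //.
- exact: prodr_ge0.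
- exact: exprn_ge0.
rewrite mulrC.
have u0S : {in S, forall l, 0 <= u l} by move=> l _.
by have [] := leif_AGM u0S.
Qed.

(* Replacing u_i and u_j by their geometric mean keeps the product and lowers
   the sum by exactly the subtracted square. *)
Lemma geometric_mean_stability (S : {set 'I_r}) (u : 'I_r -> R) i j :
  (forall l, 0 <= u l) -> i \in S -> j \in S -> i != j ->
  (\prod_(l in S) u l) `^ (#|S|%:R^-1) <=
  #|S|%:R^-1 * (\sum_(l in S) u l - (Num.sqrt (u i) - Num.sqrt (u j)) ^+ 2).
Proof.
move=> u0 iS jS ij.
have jSi : (j \in S) && (j != i) by rewrite jS eq_sym.
pose g := Num.sqrt (u i) * Num.sqrt (u j).
pose u' l := if (l == i) || (l == j) then g else u l.
have u'0 l : 0 <= u' l.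
  by rewrite /u'; case: ifP => // _; rewrite mulr_ge0 ?sqrtr_ge0.
have u'i : u' i = g by rewrite /u' eqxx.
have u'j : u' j = g by rewrite /u' eqxx orbT.
have u'E l : (l \in S) && (l != i) && (l != j) -> u' l = u l.
  by rewrite /u' => /andP[/andP[_ /negbTE ->] /negbTE ->].
have -> : \prod_(l in S) u l = \prod_(l in S) u' l.
  rewrite (bigD1 i) // (bigD1 j) //= [RHS](bigD1 i) // [in RHS](bigD1 j) //=.
  rewrite u'i u'j !mulrA; congr (_ * _); last by apply: eq_bigr => l /u'E.
  by rewrite /g -[LHS]mulr1 -{1}(sqr_sqrtr (u0 i)) -{1}(sqr_sqrtr (u0 j)); ring.
have -> : \sum_(l in S) u l - (Num.sqrt (u i) - Num.sqrt (u j)) ^+ 2 =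
    \sum_(l in S) u' l.
  rewrite (bigD1 i) // (bigD1 j) //= [RHS](bigD1 i) // [in RHS](bigD1 j) //=.
  rewrite u'i u'j (eq_bigr u u'E) /g.
  move: (sqr_sqrtr (u0 i)) (sqr_sqrtr (u0 j)).
  by move: (Num.sqrt (u i)) (Num.sqrt (u j)) => a b <- <-; ring.
by apply: geometric_mean_le => //; apply/card_gt0P; exists i.
Qed.

Lemma exists_set_card (A : {set 'I_r}) k :
  (#|A| <= k <= r)%N -> exists2 S : {set 'I_r}, A \subset S & #|S| = k.
Proof.
move=> /andP[Ak kr].
have : (k - #|A| <= #|~: A|)%N by rewrite leq_subLR cardsC card_ord.
move/card_geqP => [s [us ss sA]].
exists (A :|: [set x in s]); first exact: finset.subsetUl.
have dis : #|A :&: [set x in s]| = 0%N.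
  apply: eq_card0 => x; rewrite !inE; apply/negP => /andP[xA /sA].
  by rewrite inE xA.
by rewrite cardsU dis subn0 cardsE (card_uniqP us) ss subnKC.
Qed.

(** For stability, AM-GM is applied to every k-subset, and its quantitative form to a single one
    containing [i] and [j]; hence the constant [1 / ('C(r, k) * k)]. *)
Lemma kwise_fidelity_density k :
  (2 <= k <= r)%N -> fidelity_density (kwise_density k).
Proof.
move=> /andP[k2 kr]; have k0 : (0 < k)%N by apply: leq_trans k2.
have C0 := kwise_card_gt0 kr; have C0' := lt0r_neq0 C0.
have kR0 : (k%:R : R) != 0 by rewrite pnatr_eq0 -lt0n.
split.
- move=> u; rewrite mulr_ge0 ?invr_ge0 ?(ltW C0) // sumr_ge0 // => S _.
  exact: powR_ge0.
- move=> c u c0 u0; rewrite mulrCA; congr (_ * _); rewrite mulr_sumr.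
  apply: eq_bigr => S /eqP Sk.
  rewrite big_split /= prodr_const Sk powRM ?exprn_ge0 ?prodr_ge0 //.
  by rewrite exprn_powR_invn.
- move=> s u; congr (_ * _).
  rewrite [RHS](reindex_inj (imset_inj (@perm_inj _ s))) /=.
  apply: eq_big => [S|S _]; first by rewrite card_imset //; apply: perm_inj.
  by rewrite big_imset //= => i j _ _; apply: perm_inj.
- rewrite /kwise_density (eq_bigr (fun=> 1)) => [|S _]; last first.
    by rewrite big1_eq powR1.
  by rewrite sum_card_bin mulVf.
- move=> u u_ortho; rewrite /kwise_density big1 ?mulr0 // => S /eqP Sk.
  (* As [k >= 2], each [S] holds two distinct indices, and their factors already multiply to 0. *)
  have [s [us ss sS]] : exists s : seq 'I_r,
      [/\ uniq s, size s = 2 & {subset s <= S}].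
    by apply/card_geqP; rewrite Sk.
  case: s us ss sS => [|i [|j [|? ?]]] //= /andP[ij _] _ sS.
  rewrite inE in ij.
  have iS : i \in S by apply: sS; rewrite !inE eqxx.
  have jS : (j \in S) && (j != i).
    by rewrite sS ?inE ?eqxx ?orbT //= eq_sym.
  rewrite (bigD1 i) //= (bigD1 j) //= mulrA (u_ortho i j ij) mul0r powR0 //.
  by rewrite invr_eq0.
(* The coefficient of [u l] in the average, over all k-subsets, of their arithmetic means. *)
pose a l := 'C(r, k)%:R^-1 *
  \sum_(S : {set 'I_r} | #|S| == k) (k%:R^-1 * (l \in S)%:R) : R.
have aE (u : 'I_r -> R) : \sum_l a l * u l = 'C(r, k)%:R^-1 *
    \sum_(S : {set 'I_r} | #|S| == k) (k%:R^-1 * \sum_(l in S) u l).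
  under eq_bigr => l _ do rewrite /a -mulrA mulr_suml.
  rewrite -mulr_sumr exchange_big /=; congr (_ * _).
  apply: eq_bigr => S _; rewrite mulr_sumr big_mkcond /=.
  rewrite [RHS]big_mkcond /=; apply: eq_bigr => l _.
  by case: (l \in S); rewrite ?mulr1 // mulr0 mul0r.
exists a, ('C(r, k)%:R^-1 * k%:R^-1); split.
- under eq_bigr => l _ do rewrite -[a l]mulr1.
  rewrite (aE (fun=> 1)) (eq_bigr (fun=> 1)) => [|S /eqP Sk]; last first.
    by rewrite sumr_const Sk mulVf.
  by rewrite sum_card_bin mulVf.
- by rewrite mulr_gt0 ?invr_gt0 // ltr0n.
move=> u i j u0 ij; rewrite aE /kwise_density -mulrA -mulrBr.
rewrite ler_pM2l ?invr_gt0 //.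
have [S0 ijS /eqP S0k] :
    exists2 S : {set 'I_r}, [set i; j] \subset S & #|S| = k.
  by apply: exists_set_card; rewrite cards2 ij k2.
move: ijS; rewrite finset.subUset !finset.sub1set => /andP[iS jS].
rewrite (bigD1 S0) //= [in leRHS](bigD1 S0) //= addrAC lerD //.
  by rewrite -mulrBr -[X in X%:R^-1](eqP S0k) geometric_mean_stability.
apply: ler_sum => S /andP[/eqP Sk _].
by rewrite -[X in X%:R^-1]Sk geometric_mean_le // Sk.
Qed.

Lemma classical_fidelity_density (F : classical_functional R r) :
  (2 <= r)%N -> classical_fidelity F ->
  exists2 f, fidelity_density f &
    forall d (w : 'I_r -> 'I_d -> R), (forall i x, 0 <= w i x) ->
      F d w = \sum_x f (w^~ x).
Proof.
move=> r2 [||k kr].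
- exists (kwise_density 2); first by apply: kwise_fidelity_density.
  by move=> d w w0; rewrite avg_pairwise_kwiseE // avg_kwise_densityE.
- exists (kwise_density r); first by apply: kwise_fidelity_density; rewrite r2 /=.
  by move=> d w w0; rewrite matusita_kwiseE avg_kwise_densityE.
- exists (kwise_density k); first exact: kwise_fidelity_density.
  by move=> d w w0; rewrite avg_kwise_densityE.
Qed.

End FidelityDensities.

(** * From Hellinger distance to entries of mixtures *)

Section MinimalExtension.
Variable R : realType.
Local Notation C := R[i].
Local Notation toC := (real_complex R).

Lemma norm_toC (x : R) : `|toC x| = toC `|x|.
Proof. by rewrite normc_def /= expr0n addr0 sqrtr_sqr. Qed.

(** Young's inequality with parameter [t] for [|x - y| * |x + y|], followed by
    [(x + y)^2 <= 2 (x^2 + y^2)]. *)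
Lemma norm_sub_sqr_le (x y t : R) : 0 < t ->
  `|x ^+ 2 - y ^+ 2| <= ((x - y) ^+ 2 / t + 2 * t * (x ^+ 2 + y ^+ 2)) / 2.
Proof.
move=> t0; set q := (x - y) ^+ 2 / t.
have qE : (x - y) ^+ 2 = t * q by rewrite /q mulrC mulfVK ?lt0r_neq0.
have q0 : 0 <= q by apply: divr_ge0; [exact: sqr_ge0 | exact: ltW].
have : 2 * `|x ^+ 2 - y ^+ 2| <= q + t * (x + y) ^+ 2.
  have rhs0 : 0 <= q + t * (x + y) ^+ 2.
    by apply: addr_ge0 => //; apply: mulr_ge0; [exact: ltW | exact: sqr_ge0].
  rewrite -ler_sqr ?nnegrE ?mulr_ge0 ?normr_ge0 //.
  rewrite exprMn real_normK ?num_real // -subr_ge0.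
  (* This is [(a + b)^2 - 4ab = (a - b)^2] with [a = q] and [b = t (x + y)^2], up to a term that
     vanishes by [qE]. *)
  have -> : (q + t * (x + y) ^+ 2) ^+ 2 - 2 ^+ 2 * (x ^+ 2 - y ^+ 2) ^+ 2 =
            (q - t * (x + y) ^+ 2) ^+ 2
            + 4 * (x + y) ^+ 2 * (t * q - (x - y) ^+ 2) by ring.
  by rewrite qE subrr mulr0 addr0 sqr_ge0.
have : t * (x + y) ^+ 2 <= t * (2 * (x ^+ 2 + y ^+ 2)).
  rewrite ler_pM2l // -subr_ge0.
  have -> : 2 * (x ^+ 2 + y ^+ 2) - (x + y) ^+ 2 = (x - y) ^+ 2 by ring.
  exact: sqr_ge0.
lra.
Qed.

(** The previous bound at the square roots, summed; the term [2 * t] comes from the total mass 2 of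
    [p] and [q]. The free parameter [t] plays the part of Cauchy-Schwarz. *)
Lemma l1_le_hellinger (T : finType) (p q : T -> R) (t : R) :
  is_distribution p -> is_distribution q -> 0 < t ->
  \sum_x `|p x - q x| <=
  (\sum_x (Num.sqrt (p x) - Num.sqrt (q x)) ^+ 2) / t / 2 + 2 * t.
Proof.
move=> [p0 p1] [q0 q1] t0.
have -> : (\sum_x (Num.sqrt (p x) - Num.sqrt (q x)) ^+ 2) / t / 2 + 2 * t =
    \sum_x (((Num.sqrt (p x) - Num.sqrt (q x)) ^+ 2 / t
             + 2 * t * (p x + q x)) / 2).
  rewrite -[RHS]mulr_suml big_split /= -mulr_suml -mulr_sumr big_split /= p1 q1.
  by field; rewrite lt0r_neq0.
apply: ler_sum => x _.
have := norm_sub_sqr_le (Num.sqrt (p x)) (Num.sqrt (q x)) t0.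
by rewrite !sqr_sqrtr.
Qed.

(** Every entry of a state has modulus at most its trace, which is 1. *)
Lemma mix_entry_dist (T : finType) n (p q : T -> R) (sigma : T -> 'M[C]_n) a b :
  (forall t, is_state (sigma t)) ->
  `|(\sum_t toC (p t) *: sigma t) a b - (\sum_t toC (q t) *: sigma t) a b| <=
  toC (\sum_t `|p t - q t|).
Proof.
move=> st; rewrite !summxE -sumrB rmorph_sum.
apply: le_trans (ler_norm_sum _ _ _) _; apply: ler_sum => t _.
rewrite !mxE -mulrBl -rmorphB normrM norm_toC -[leRHS]mulr1.
rewrite ler_wpM2l ?toC_ge0 ?normr_ge0 //.
by rewrite -(st t).2; apply: psd_entry; case: (st t).
Qed.

(** * Blocks of direct sums *)

Lemma tens_sumr (T : finType) k n (A : 'M[C]_k) (c : T -> C)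
    (B : T -> 'M[C]_n) :
  A *t (\sum_t c t *: B t) = \sum_t c t *: (A *t B t).
Proof.
apply/matrixP => u v; rewrite summxE !mxE summxE mulr_sumr.
by apply: eq_bigr => t _; rewrite !mxE mulrCA.
Qed.

Lemma mxtrace_tens_block k n (A : 'M[C]_(k * n)) :
  \tr A = \sum_(i < k) \tr (tens_block A i i).
Proof.
rewrite /mxtrace.
under [RHS]eq_bigr => i _ do under eq_bigr => a _ do rewrite mxE.
rewrite pair_big /=.
rewrite (reindex (@mxtens_index k n)) /=; first by apply: eq_bigr => [[]].
exists (@mxtens_unindex k n) => x _; [exact: mxtens_indexK|exact: mxtens_unindexK].
Qed.

Lemma tens_block_cq (X : finType) n (p : X -> R) (rho : X -> 'M[C]_n) x :
  tens_block (cq_operator p rho) (enum_rank x) (enum_rank x) =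
  toC (p x) *: rho x.
Proof.
apply/matrixP => a b; rewrite mxE summxE (bigD1 x) //= big1 => [|y yx].
  by rewrite mxE tensmxE !mxE !eqxx mul1r addr0.
rewrite mxE tensmxE !mxE (inj_eq enum_rank_inj) eq_sym (negbTE yx).
by rewrite mul0r mulr0.
Qed.

Lemma state_cq (X : finType) n (p : X -> R) (rho : X -> 'M[C]_n) :
  is_distribution p -> (forall x, is_state (rho x)) ->
  is_state (cq_operator p rho).
Proof.
move=> pd st; apply: state_mix => // x; apply: state_tens => //.
exact: state_delta.
Qed.

(** * Values of preparations and their supremum *)

Variables (r : nat) (F : classical_functional R r) (f : ('I_r -> R) -> R).
Hypothesis r_ge2 : (2 <= r)%N.
Hypothesis f_density : fidelity_density f.
Hypothesis F_sum : forall d (w : 'I_r -> 'I_d -> R), (forall i x, 0 <= w i x) ->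
  F w = \sum_x f (w^~ x).

Let i0 : 'I_r := Ordinal (ltnW r_ge2).
Let i1 : 'I_r := Ordinal r_ge2.

(** Summed over the letters, the linear part of the stability bound is 1. The constant is chosen
    before the alphabet and the weights, so it is uniform over all preparations. *)
Lemma density_sum_stable : exists2 c, 0 < c &
  forall (T : finType) (w : 'I_r -> T -> R) i j,
    (forall i, is_distribution (w i)) -> i != j ->
    \sum_t f (w^~ t) <=
    1 - c * \sum_t (Num.sqrt (w i t) - Num.sqrt (w j t)) ^+ 2.
Proof.
have [a [c [a1 c0 st]]] := density_stable f_density.
exists c => // T w i j wd ij.
have -> : 1 = \sum_t \sum_l a l * w l t.
  rewrite exchange_big -a1; apply: eq_bigr => l _.
  by rewrite -mulr_sumr (wd l).2 mulr1.
rewrite mulr_sumr -sumrB; apply: ler_sum => t _.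
by apply: st => // l; apply: (wd l).1.
Qed.

Lemma density_sum_le1 (T : finType) (w : 'I_r -> T -> R) :
  (forall i, is_distribution (w i)) -> \sum_t f (w^~ t) <= 1.
Proof.
move=> wd; have [c c0 /(_ T w i0 i1 wd isT)/le_trans] := density_sum_stable.
apply; rewrite gerBl mulr_ge0 ?(ltW c0) // sumr_ge0 // => t _; exact: sqr_ge0.
Qed.

Lemma preparation_valuesE n (rho : 'I_r -> 'M[C]_n) (v : R) :
  preparation_values F rho v <->
  exists d (w : 'I_r -> 'I_d -> R) (sigma : 'I_d -> 'M[C]_n),
    is_preparation w sigma rho /\ v = \sum_x f (w^~ x).
Proof.
rewrite preparation_valuesP; split=> -[d [w [sigma [wp ->]]]];
  exists d, w, sigma; split=> //; rewrite F_sum // => i x.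
- by case: wp => wd _ _; apply: (wd i).1.
- by case: wp => wd _ _; apply: (wd i).1.
Qed.

Lemma preparation_reindex (T : finType) n (w : 'I_r -> T -> R)
    (sigma : T -> 'M[C]_n) rho :
  is_preparation w sigma rho -> preparation_values F rho (\sum_t f (w^~ t)).
Proof.
move=> [wd st rhoE]; apply/preparation_valuesE.
have bij := onW_bij predT (enum_val_bij T).
exists #|T|, (fun i x => w i (enum_val x)), (sigma \o enum_val).
split; last by rewrite (reindex _ bij).
split=> [i|x|i].
- case: (wd i) => w0 w1; split=> // .
  by rewrite -w1 [RHS](reindex _ bij).
- exact: st.
- by rewrite rhoE (reindex _ bij).
Qed.

Lemma has_ubound_values n (rho : 'I_r -> 'M[C]_n) :
  has_ubound (preparation_values F rho).
Proof.
exists 1 => v /preparation_valuesE[d [w [sigma [[wd _ _] ->]]]].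
exact: density_sum_le1.
Qed.

(** The letters are the indices themselves: letter [t] prepares [rho t], and the i-th distribution
    is the point mass at [i]. Together with boundedness this makes [sup] a genuine least upper
    bound. *)
Lemma values_nonempty n (rho : 'I_r -> 'M[C]_n) :
  (forall i, is_state (rho i)) -> (preparation_values F rho !=set0)%classic.
Proof.
move=> st; exists (\sum_(t < r) f (fun i => (i == t)%:R)).
apply: (@preparation_reindex _ _ (fun i t => (i == t)%:R) rho); split=> // i.
  split=> [t|]; first exact: ler0n.
  rewrite (bigD1 i) //= eqxx big1 ?addr0 // => t.
  by rewrite eq_sym => /negbTE ->.
rewrite (bigD1 i) //= eqxx rmorph1 scale1r big1 ?addr0 // => t.
by rewrite eq_sym => /negbTE ->; rewrite rmorph0 scale0r.
Qed.

Lemma le_minimal_extension (T : finType) n (w : 'I_r -> T -> R)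
    (sigma : T -> 'M[C]_n) rho :
  is_preparation w sigma rho -> \sum_t f (w^~ t) <= minimal_extension F rho.
Proof.
move=> /preparation_reindex; apply: ub_le_sup; exact: has_ubound_values.
Qed.

Lemma minimal_extension_le n (rho : 'I_r -> 'M[C]_n) (b : R) :
  (forall i, is_state (rho i)) ->
  (forall d (w : 'I_r -> 'I_d -> R) sigma, is_preparation w sigma rho ->
    \sum_t f (w^~ t) <= b) ->
  minimal_extension F rho <= b.
Proof.
move=> st ub; apply: ge_sup; first exact: values_nonempty.
by move=> v /preparation_valuesE[d [w [sigma [wp ->]]]]; apply: ub wp.
Qed.

Lemma minimal_extension_adherent n (rho : 'I_r -> 'M[C]_n) (e : R) :
  (forall i, is_state (rho i)) -> 0 < e ->
  exists d (w : 'I_r -> 'I_d -> R) (sigma : 'I_d -> 'M[C]_n),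
    is_preparation w sigma rho /\
    minimal_extension F rho - e < \sum_t f (w^~ t).
Proof.
move=> st e0.
have sup : has_sup (preparation_values F rho).
  by split; [exact: values_nonempty | exact: has_ubound_values].
have [v /preparation_valuesE[d [w [sigma [wp ->]]]] lt] := sup_adherent e0 sup.
by exists d, w, sigma.
Qed.

Lemma minimal_extension_ge0 n (rho : 'I_r -> 'M[C]_n) :
  (forall i, is_state (rho i)) -> 0 <= minimal_extension F rho.
Proof.
move=> st; have [d [w [sigma [/le_minimal_extension le _]]]] :=
  minimal_extension_adherent st ltr01.
by apply: le_trans le; apply: sumr_ge0 => t _; apply: density_ge0.
Qed.

Lemma minimal_extension_le1 n (rho : 'I_r -> 'M[C]_n) :
  (forall i, is_state (rho i)) -> minimal_extension F rho <= 1.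
Proof.
move=> st; apply: minimal_extension_le => // d w sigma [wd _ _].
exact: density_sum_le1.
Qed.

(** * Data processing, symmetry and faithfulness *)

Lemma data_processing n m (rho : 'I_r -> 'M[C]_n)
    (N : {linear 'M[C]_n -> 'M[C]_m}) :
  (forall i, is_state (rho i)) -> is_channel N ->
  minimal_extension F rho <= minimal_extension F (fun i => N (rho i)).
Proof.
move=> st chN; apply: minimal_extension_le => // d w sigma [wd sst rhoE].
apply: (@le_minimal_extension _ _ w (fun t => N (sigma t))); split=> // [t|i].
  exact: state_channel.
by rewrite rhoE raddf_sum; apply: eq_bigr => t _; rewrite /= linearZ.
Qed.

Lemma minimal_extension_perm n (rho : 'I_r -> 'M[C]_n) (s : {perm 'I_r}) :
  (forall i, is_state (rho i)) ->
  minimal_extension F rho = minimal_extension F (fun i => rho (s i)).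
Proof.
have le (tau : 'I_r -> 'M[C]_n) (u : {perm 'I_r}) :
    (forall i, is_state (tau i)) ->
    minimal_extension F tau <= minimal_extension F (fun i => tau (u i)).
  move=> st; apply: minimal_extension_le => // d w sigma [wd sst tauE].
  rewrite (_ : \sum_t _ = \sum_t f (fun i => w (u i) t)); last first.
    by apply: eq_bigr => t _; rewrite -(density_perm f_density u).
  exact: (@le_minimal_extension _ _ (fun i => w (u i)) sigma).
move=> st; apply/le_anti; rewrite le //=.
(* The converse is the same inequality for the permuted family and the inverse permutation. *)
apply: le_trans (le _ (s^-1)%g _) _ => //.
rewrite le_eqVlt; apply/orP; left; apply/eqP; congr minimal_extension.
by apply/funext => i; rewrite permKV.
Qed.

(** A one-letter alphabet prepares the common state with value [f (fun=> 1) = 1]. *)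
Lemma minimal_extension_const n (rho : 'I_r -> 'M[C]_n) :
  (forall i, is_state (rho i)) -> (forall i j, rho i = rho j) ->
  minimal_extension F rho = 1.
Proof.
move=> st rho_eq; apply/le_anti; rewrite minimal_extension_le1 //=.
rewrite [leLHS](_ : 1 = \sum_(t < 1) f (fun=> 1)); last first.
  by rewrite big_ord1 (density1 f_density).
apply: (@le_minimal_extension _ _ (fun _ _ => 1) (fun=> rho i0)).
split=> // i; first by split=> //; rewrite big_ord1.
by rewrite big_ord1 rmorph1 scale1r.
Qed.

(** No optimal preparation is assumed to exist: near-optimal ones bring the entries of [rho i] and
    [rho j] within every [e > 0] of each other. *)
Lemma minimal_extension1_eq n (rho : 'I_r -> 'M[C]_n) :
  (forall i, is_state (rho i)) -> minimal_extension F rho = 1 ->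
  forall i j, rho i = rho j.
Proof.
move=> st ext1 i j; have [-> //|ij] := eqVneq i j.
have [c c0 stable] := density_sum_stable.
have small a b (e : R) : 0 < e -> `|rho i a b - rho j a b| <= toC e.
  (* A value within [c * (e / 4 * e)] of 1 makes the squared Hellinger sum at most [e^2 / 4]; with
     [t = e / 4] both terms of the l1 bound are then at most [e / 2]. *)
  move=> e0; have t0 : 0 < e / 4 by lra.
  have h0 : 0 < c * (e / 4 * e) by rewrite !mulr_gt0.
  have [d [w [sigma [[wd sst rhoE] lt]]]] := minimal_extension_adherent st h0.
  rewrite !rhoE; apply: le_trans (mix_entry_dist _ _ _ _ sst) _.
  rewrite lecR; apply: le_trans (l1_le_hellinger (wd i) (wd j) t0) _.
  have := stable _ w i j wd ij; set S := \sum_t (_ - _) ^+ 2 => leS.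
  have : S <= e / 4 * e.
    rewrite -(ler_pM2l c0); have := lt_le_trans lt leS; rewrite ext1; lra.
  by rewrite -[_ * e]mulrC -ler_pdivrMr //; lra.
apply/matrixP => a b; apply/eqP; rewrite -subr_eq0 -normr_eq0.
apply: contraT => z0; set z := `|_| in z0.
have zE : toC (complex.Re z) = z by apply: RRe_real; apply: normr_real.
have zR0 : 0 < complex.Re z.
  by rewrite -ltcR zE lt_def z0 normr_ge0.
(* A positive distance would be at most half of itself. *)
have : z <= toC (complex.Re z / 2) by apply: small; lra.
rewrite -{1}zE lecR; lra.
Qed.

(** * Direct-sum property *)

Lemma cq_minimal_extension_ge n (X : finType) (p : X -> R)
    (rho : 'I_r -> X -> 'M[C]_n) :
  is_distribution p -> (forall i x, is_state (rho i x)) ->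
  \sum_x p x * minimal_extension F (rho^~ x) <=
  minimal_extension F (fun i => cq_operator p (rho i)).
Proof.
move=> [p0 p1] st; apply/ler_addgt0Pr => e e0.
(* Alphabet size, weights and states are bundled in one type, so that a near-optimal preparation can
   be chosen for all [x] at once. *)
pose prep := {d : nat & (('I_r -> 'I_d -> R) * ('I_d -> 'M[C]_n))%type}.
have /choice[g gP] x : exists g : prep,
    is_preparation (tagged g).1 (tagged g).2 (rho^~ x) /\
    minimal_extension F (rho^~ x) - e < \sum_t f ((tagged g).1^~ t).
  have [d [w [sigma H]]] := minimal_extension_adherent (st^~ x) e0.
  by exists (existT _ d (w, sigma)).
(* The glued alphabet: a letter of [X] together with a letter of the preparation chosen for it. *)
pose T := {x : X & 'I_(tag (g x))}.
pose w i (t : T) := p (tag t) * (tagged (g (tag t))).1 i (tagged t).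
pose sigma (t : T) : 'M[C]_(#|X| * n) :=
  delta_mx (enum_rank (tag t)) (enum_rank (tag t))
  *t (tagged (g (tag t))).2 (tagged t).
have wp : is_preparation w sigma (fun i => cq_operator p (rho i)).
  split=> [i|t|i].
  - split=> [[x y]|].
      by rewrite mulr_ge0 //; case: (gP x) => -[/(_ i)[]].
    rewrite -p1 /w -(sig_big_dep (fun=> true) (fun _ _ => true)
      (fun x y => p x * (tagged (g x)).1 i y)) /=.
    apply: eq_bigr => x _; rewrite -mulr_sumr.
    by case: (gP x) => -[/(_ i)[_ ->]]; rewrite mulr1.
  - apply: state_tens; first exact: state_delta.
    by case: (gP (tag t)) => -[].
  - rewrite /cq_operator /w /sigma.
    rewrite -(sig_big_dep (fun=> true) (fun _ _ => true)
      (fun x y => toC (p x * (tagged (g x)).1 i y) *: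
      (delta_mx (enum_rank x) (enum_rank x) *t (tagged (g x)).2 y))) /=.
    apply: eq_bigr => x _; case: (gP x) => -[_ _ ->] _.
    rewrite tens_sumr scaler_sumr; apply: eq_bigr => y _.
    by rewrite scalerA rmorphM.
rewrite -lerBlDr; apply: le_trans (le_minimal_extension wp).
(* The losses [e] of the separate preparations average to [e], not to a multiple of it. *)
have -> : e = \sum_x p x * e by rewrite -mulr_suml p1 mul1r.
rewrite -sumrB /w -(sig_big_dep (fun=> true) (fun _ _ => true) (fun x y =>
  f (fun i => p x * (tagged (g x)).1 i y))) /=.
apply: ler_sum => x _; case: (gP x) => -[gd _ _] /ltW le.
rewrite -mulrBr; apply: le_trans (ler_wpM2l (p0 x) le) _.
rewrite mulr_sumr; apply: ler_sum => y _.
by rewrite (density_scale f_density) // => i; case: (gd i).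
Qed.

(* Compressing the preparation states to the block of x turns a preparation of
   the direct sum into one of the x-th family, with weights reweighted by the
   probability t of finding the y-th preparation state in that block. *)
Lemma cq_block_le n (X : finType) (p : X -> R) (rho : 'I_r -> X -> 'M[C]_n)
    d (w : 'I_r -> 'I_d -> R) (sigma : 'I_d -> 'M[C]_(#|X| * n)) x :
  (forall x, 0 <= p x) -> (forall i x, is_state (rho i x)) ->
  is_preparation w sigma (fun i => cq_operator p (rho i)) ->
  \sum_y complex.Re (\tr (tens_block (sigma y) (enum_rank x) (enum_rank x)))
    * f (w^~ y) <=
  p x * minimal_extension F (rho^~ x).
Proof.
move=> p0 st [wd sst rhoE].
pose blk y := tens_block (sigma y) (enum_rank x) (enum_rank x).
have blk_psd y : psd (blk y).
  by apply: (psd_mxsub (fun a => mxtens_index (enum_rank x, a))); case: (sst y).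
pose t y := complex.Re (\tr (blk y)).
have tE y : toC (t y) = \tr (blk y).
  by apply: RRe_real; apply: ger0_real; apply: psd_tr.
have t0 y : 0 <= t y by rewrite -toC_ge0 tE psd_tr.
have blkE i : toC (p x) *: rho i x = \sum_y toC (w i y) *: blk y.
  rewrite -tens_block_cq rhoE; apply/matrixP => a b.
  by rewrite !mxE !summxE; apply: eq_bigr => y _; rewrite !mxE.
have wt i : \sum_y w i y * t y = p x.
  apply: (@complexI R); rewrite -[RHS]mulr1 -(st i x).2 -mxtraceZ blkE.
  rewrite rmorph_sum raddf_sum /=; apply: eq_bigr => y _.
  by rewrite mxtraceZ -tE rmorphM.
have w0 i y : 0 <= w i y by case: (wd i).
have scale c y : 0 <= c -> c * f (w^~ y) = f (fun i => c * w i y).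
  by move=> c0; rewrite (density_scale f_density).
rewrite -[leLHS]/(\sum_y t y * f (w^~ y)).
(* If [p x = 0], every [w i y * t y] vanishes, so each term on the left is [f] at the zero
   vector. *)
have [px0|px0] := eqVneq (p x) 0.
  rewrite px0 mul0r big1 // => y _; rewrite scale //.
  apply: (density_ortho f_density) => i j _.
  have /eqP := wt i; rewrite px0 psumr_eq0 => [/allP/(_ y)|z _];
    last exact: mulr_ge0.
  by rewrite mem_index_enum => /(_ isT)/eqP; rewrite mulrC => ->; rewrite mul0r.
have px_gt0 : 0 < p x by rewrite lt_def px0 p0.
pose w' i y := t y / p x * w i y.
(* A block of trace 0 cannot be normalized; its new weight is 0, so any state can stand in for
   it. *)
pose sigma' y := if t y == 0 then rho i0 x else toC (t y)^-1 *: blk y.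
have t_sigma' y : toC (t y) *: sigma' y = blk y.
  rewrite /sigma'; case: eqP => [ty|/eqP ty].
    rewrite ty rmorph0 scale0r; symmetry; apply: psd_tr0 => //.
    by rewrite -tE ty rmorph0.
  by rewrite scalerA -rmorphM mulfV // rmorph1 scale1r.
have wp : is_preparation w' sigma' (rho^~ x).
  split=> [i|y|i].
  - split=> [y|]; first by rewrite mulr_ge0 ?divr_ge0.
    under eq_bigr => y _ do rewrite /w' mulrAC [t y * _]mulrC.
    by rewrite -mulr_suml wt mulfV.
  - rewrite /sigma'; case: eqP => [//|/eqP ty]; split.
      by apply: psdZ => //; rewrite toC_ge0 invr_ge0.
    by rewrite mxtraceZ -tE -rmorphM mulVf // rmorph1.
  - have pC : toC (p x) != 0 by rewrite fmorph_eq0.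
    apply: (scalerI pC); rewrite blkE scaler_sumr; apply: eq_bigr => y _.
    rewrite -t_sigma' !scalerA -!rmorphM /w'; congr (toC _ *: _).
    by field.
apply: le_trans (ler_wpM2l (p0 x) (le_minimal_extension wp)).
rewrite mulr_sumr; apply: ler_sum => y _.
rewrite /w' -scale ?divr_ge0 // mulrA.
by rewrite [p x * _]mulrC mulfVK.
Qed.

(** The block bounds are added over [x]: the block traces of each prepared state sum to 1, which
    recovers the value of the original preparation. *)
Lemma cq_minimal_extension_le n (X : finType) (p : X -> R)
    (rho : 'I_r -> X -> 'M[C]_n) :
  is_distribution p -> (forall i x, is_state (rho i x)) ->
  minimal_extension F (fun i => cq_operator p (rho i)) <=
  \sum_x p x * minimal_extension F (rho^~ x).
Proof.
move=> pd st; apply: minimal_extension_le => [i|d w sigma wp].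
  exact: state_cq.
apply: le_trans (ler_sum _ (fun x _ => cq_block_le x pd.1 st wp)).
rewrite exchange_big le_eqVlt; apply/orP; left; apply/eqP.
apply: eq_bigr => y _; rewrite -mulr_suml.
case: wp => _ /(_ y)[_ try1] _.
suff -> : \sum_x complex.Re
    (\tr (tens_block (sigma y) (enum_rank x) (enum_rank x))) = 1.
  by rewrite mul1r.
have <- : complex.Re (1 : C) = 1 by [].
rewrite -try1 mxtrace_tens_block.
rewrite [in RHS](reindex _ (onW_bij predT (@enum_rank_bij X))).
by rewrite raddf_sum.
Qed.

(** * Weak orthogonality *)

Lemma minimal_extension_orthogonal n (rho : 'I_r -> 'M[C]_n) :
  (forall i, is_state (rho i)) -> (forall i j, i != j -> rho i *m rho j = 0) ->
  minimal_extension F rho = 0.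
Proof.
move=> st ortho; apply/le_anti; rewrite minimal_extension_ge0 // andbT.
apply: minimal_extension_le => // d w sigma [wd sst rhoE].
have w0 i x : 0 <= w i x by case: (wd i).
have tr_ge0 x y : 0 <= \tr (sigma x *m sigma y).
  by apply: psd_trM; [case: (sst x) | case: (sst y)].
rewrite big1 // => x _; apply: (density_ortho f_density) => i j ij.
(* Expansion of [\tr (rho i *m rho j) = 0]. All terms are nonnegative, hence zero, and the diagonal
   ones [y = x] are used. *)
have : \sum_x \sum_y toC (w i x * w j y) * \tr (sigma x *m sigma y) = 0.
  rewrite -[RHS](mxtrace0 C n) -(ortho i j ij) !rhoE mulmx_suml raddf_sum /=.
  apply: eq_bigr => x' _; rewrite mulmx_sumr raddf_sum /=; apply: eq_bigr => y _.
  by rewrite -scalemxAl -scalemxAr scalerA mxtraceZ rmorphM.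
have term_ge0 a b : 0 <= toC (w i a * w j b) * \tr (sigma a *m sigma b).
  by rewrite mulr_ge0 ?toC_ge0 ?mulr_ge0.
move/eqP; rewrite psumr_eq0 => [/allP/(_ x)|a _]; last exact: sumr_ge0.
rewrite mem_index_enum => /(_ isT); rewrite psumr_eq0 // => /allP/(_ x).
rewrite mem_index_enum => /(_ isT); rewrite mulf_eq0 fmorph_eq0.
case/orP => [/eqP //|/eqP].
(* The other alternative would make [sigma x] zero, against its unit trace. *)
move/psd_sqr_eq0 => sx0; case: (sst x) => psx.
rewrite sx0 // mxtrace0 => /esym/eqP; by rewrite oner_eq0.
Qed.

End MinimalExtension.


Theorem mainTheorem17 (R : realType) (r : nat) (hr : (2 <= r)%N)
    (F : classical_functional R r) (hF : classical_fidelity F) :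
  [/\ (* (i) data processing *)
      forall (n : nat) (rho : 'I_r -> 'M[R[i]]_n),
        (forall i, is_state (rho i)) ->
        forall (m : nat) (N : {linear 'M[R[i]]_n -> 'M[R[i]]_m}),
          is_channel N ->
          minimal_extension F rho <= minimal_extension F (fun i => N (rho i)),
      (* (ii) symmetry *)
      forall (n : nat) (rho : 'I_r -> 'M[R[i]]_n),
        (forall i, is_state (rho i)) ->
        forall s : {perm 'I_r},
          minimal_extension F rho = minimal_extension F (fun i => rho (s i)),
      (* (iii) faithfulness *)
      forall (n : nat) (rho : 'I_r -> 'M[R[i]]_n),
        (forall i, is_state (rho i)) ->
        (minimal_extension F rho = 1 <-> forall i j, rho i = rho j),
      (* (iv) direct-sum property *)
      forall (n : nat) (X : finType) (p : X -> R)
             (rho : 'I_r -> X -> 'M[R[i]]_n),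
        is_distribution p ->
        (forall i x, is_state (rho i x)) ->
        minimal_extension F (fun i => cq_operator p (rho i)) =
        \sum_(x : X) p x * minimal_extension F (fun i => rho i x)
    & (* (v) weak orthogonality *)
      forall (n : nat) (rho : 'I_r -> 'M[R[i]]_n),
        (forall i, is_state (rho i)) ->
        (forall i j, i != j -> rho i *m rho j = 0) ->
        minimal_extension F rho = 0].
Proof.
have [f f_dens F_sum] := classical_fidelity_density hr hF.
split.
- by move=> n rho st m N chN; apply: (data_processing hr f_dens F_sum).
- by move=> n rho st s; apply: (minimal_extension_perm hr f_dens F_sum).
- move=> n rho st; split=> [|eq_rho].
    exact: (minimal_extension1_eq hr f_dens F_sum).
  exact: (minimal_extension_const hr f_dens F_sum).
- move=> n X p rho pd st; apply/le_anti.
  rewrite (cq_minimal_extension_le hr f_dens F_sum) //.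
  exact: (cq_minimal_extension_ge hr f_dens F_sum).
- by move=> n rho st ortho; apply: (minimal_extension_orthogonal hr f_dens F_sum).
Qed.
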